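(* For any reduced Hecke pair $(G,H)$, the Schlichting completion is a topological inverse limit: $$\overline G=\varprojlim_{F\subseteq G/H\ \text{finite}}G/G_F,\qquad\text{where } G_F=\bigcap_{xH\in F}xHx^{-1}.$$
   Context: $(G,H)$ ($H$ a subgroup of a group $G$) is a Hecke pair if every double coset $HxH$ is a finite union of left cosets of $H$; it is reduced if $\bigcap_{x\in G}xHx^{-1}=\{e\}$. Let $\mathrm{Map}(G/H)$ be the set of all maps $G/H\to G/H$ with the topology of pointwise convergence ($G/H$ discrete), and let $\theta(x)(yH)=xyH$. The Schlichting completion is $\overline G=\overline{\theta(G)}$, $\overline H=\overline{\theta(H)}$ (closures in $\mathrm{Map}(G/H)$), and $\overline G$ carries the relative topology. The inverse limit is one of topological spaces: each $G/G_F$ is discrete, the finite subsets $F$ of $G/H$ are directed by inclusion, and for $E\subseteq F$ the bonding map $G/G_F\to G/G_E$ is $xG_F\mapsto xG_E$. The equality is the identification by restriction of maps: $xG_F$ is identified with the restriction $\theta(x)|_F:F\to G/H$, and $\phi\in\overline G$ corresponds to the family $(\phi|_F)_F$. *)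

(* Defs.v *)
From HB Require Import structures.
From mathcomp Require Import all_boot monoid.
From mathcomp Require Import finmap.
From mathcomp Require Import all_classical topology.

Set Implicit Arguments.
Unset Strict Implicit.
Unset Printing Implicit Defensive.

Local Open Scope group_scope.
Local Open Scope classical_set_scope.

Definition homeomorphism (X Y : topologicalType) (f : X -> Y) : Prop :=
  continuous f /\
  exists g : Y -> X, [/\ cancel f g, cancel g f & continuous g].

(* The threads of the inverse system [b], topologized as a subspace of the
   product. *)
Definition inverse_limit (I : Type) (le : rel I) (X : I -> topologicalType)
    (b : forall i j, le i j -> X j -> X i) : topologicalType :=
  [set x : prod_topology X |
    forall (i j : I) (ij : le i j), b i j ij (x j) = x i].

Section Cosets.
Variable G : groupType.
Implicit Types (K L : groupClosed G) (x y : G).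

Definition lcoset K x : set G := [set x * k | k in [set` K]].

Definition double_coset K x : set G :=
  [set h * x * k | h in [set` K] & k in [set` K]].

Definition conjset K x : set G := [set x * k * x^-1 | k in [set` K]].

(* The set G/K of left cosets, each of them a subset of G. *)
Definition coset_space K : Type := discrete_topology (range (lcoset K)).

HB.instance Definition _ K :=
  DiscreteTopology.copy (coset_space K) (discrete_topology (range (lcoset K))).

Lemma lcoset_range K x : lcoset K x \in range (lcoset K).
Proof. by apply/mem_set; exists x. Qed.

Definition coset K x : coset_space K := exist _ (lcoset K x) (lcoset_range K x).

Lemma cosetP K (A : coset_space K) : exists x, A = coset K x.
Proof.
case: A => A p; have /set_mem[x _ e] := p; exists x.
by apply: val_inj; rewrite /= e.
Qed.

Lemma translate_subproof K x (A : coset_space K) :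
  [set x * a | a in sval A] \in range (lcoset K).
Proof.
have [y ->] := cosetP A; apply/mem_set; exists (x * y) => //.
rewrite eqEsubset; split => [_ [k Kk <-]|_ [_ [k Kk <-] <-]] /=.
  by exists (y * k); [exists k|rewrite mulgA].
by exists k; rewrite ?mulgA.
Qed.

(* yK |-> xyK *)
Definition translate K x (A : coset_space K) : coset_space K :=
  exist _ [set x * a | a in sval A] (translate_subproof x A).

Lemma translate_coset K x y : translate x (coset K y) = coset K (x * y).
Proof.
apply: val_inj; rewrite /= eqEsubset.
split => [_ [_ [k Kk <-] <-]|_ [k Kk <-]].
  by exists k; rewrite ?mulgA.
by exists (y * k); [exists k|rewrite mulgA].
Qed.

Lemma coset_map_subproof K L (KL : {subset K <= L}) (A : coset_space K) :
  [set a * l | a in sval A & l in [set` L]] \in range (lcoset L).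
Proof.
have [x ->] := cosetP A; apply/mem_set; exists x => //.
rewrite eqEsubset; split => [_ [l Ll <-]|_ [_ [k Kk <-] [l Ll <-]]] /=.
  by exists x; [exists 1; [exact: gpred1|rewrite mulg1]|exists l].
by exists (k * l); [apply: gpredM => //; exact: KL|rewrite mulgA].
Qed.

(* xK |-> xL *)
Definition coset_map K L (KL : {subset K <= L}) (A : coset_space K) :
    coset_space L :=
  exist _ [set a * l | a in sval A & l in [set` L]] (coset_map_subproof KL A).

Lemma coset_map_coset K L (KL : {subset K <= L}) x :
  coset_map KL (coset K x) = coset L x.
Proof.
apply: val_inj; rewrite /= eqEsubset.
split => [_ [_ [k Kk <-] [l Ll <-]]|_ [l Ll <-]] /=.
  by exists (k * l); [apply: gpredM => //; exact: KL|rewrite mulgA].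
by exists x; [exists 1; [exact: gpred1|rewrite mulg1]|exists l].
Qed.

End Cosets.

Section Schlichting.
Variables (G : groupType) (H : groupClosed G).

Definition Hecke_pair : Prop :=
  forall x : G, exists2 S : set G, finite_set S &
    double_coset H x = \bigcup_(y in S) lcoset H y.

Definition reduced : Prop := \bigcap_(x in [set: G]) conjset H x = [set 1].

Definition Map : topologicalType := {ptws coset_space H -> coset_space H}.

Definition theta (x : G) : Map := @translate G H x.

Definition schlichting : topologicalType := closure (range theta).

Definition stab (F : {fset coset_space H}) : {pred G} :=
  [pred g | g \in \bigcap_(x in [set x | coset H x \in F]) conjset H x].

Lemma stabP F g :
  reflect (forall x, coset H x \in F -> x^-1 * g * x \in H) (g \in stab F).
Proof.
apply: (iffP idP) => [/set_mem Fg x /Fg[k Kk <-]|Fg].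
  by rewrite !mulgA mulVg mul1g mulgVK.
apply/mem_set => x /Fg Hg; exists (x^-1 * g * x) => //.
by rewrite !mulgA mulgV mul1g mulgK.
Qed.

Section StabGroup.
Variable F : {fset coset_space H}.

Let stab1 : 1 \in stab F.
Proof. by apply/stabP => x _; rewrite mulg1 mulVg gpred1. Qed.

Let stabM : mulg_closed (stab F).
Proof.
move=> g h /stabP Fg /stabP Fh; apply/stabP => x Fx.
have -> : x^-1 * (g * h) * x = (x^-1 * g * x) * (x^-1 * h * x).
  by rewrite !mulgA mulgK.
by apply: gpredM; [exact: Fg|exact: Fh].
Qed.

Let stabV : invg_closed (stab F).
Proof.
move=> g /stabP Fg; apply/stabP => x Fx.
have -> : x^-1 * g^-1 * x = (x^-1 * g * x)^-1 by rewrite !invgM invgK mulgA.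
by rewrite gpredV; exact: Fg.
Qed.

HB.instance Definition _ := isMulClosed.Build G (stab F) stabM.
HB.instance Definition _ := isMul1Closed.Build G (stab F) stab1.
HB.instance Definition _ := isInvClosed.Build G (stab F) stabV.

End StabGroup.

Lemma stabS (E F : {fset coset_space H}) :
  (E `<=` F)%fset -> {subset stab F <= stab E}.
Proof.
by move=> /fsubsetP EF g /stabP Fg; apply/stabP => x /EF; exact: Fg.
Qed.

(* xG_F |-> xG_E *)
Definition bonding (E F : {fset coset_space H}) (EF : (E `<=` F)%fset) :
    coset_space (stab F) -> coset_space (stab E) :=
  coset_map (stabS EF).

Definition limit_of_quotients : topologicalType := inverse_limit bonding.

End Schlichting.

Arguments theta {G} H x.

(* Main.v *)
(** Both sides carry the topology of pointwise convergence of a family of maps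
    into discrete spaces, and [G_F] is the stabilizer of the finite set [F], so
    that [xG_F] and the restriction of [theta x] to [F] determine each other.
    A map lies in the closure of [theta G] iff on each finite set it agrees with
    some [theta x], i.e. iff it defines a thread [(xG_F)_F]; conversely a thread
    is recovered from its components at the singletons.  Neither side of this
    correspondence looks at more than finitely many coordinates at a time, which
    is continuity. *)
Require Import Defs.
From HB Require Import structures.
From mathcomp Require Import all_boot monoid.
From mathcomp Require Import finmap.
From mathcomp Require Import all_classical topology.

Set Implicit Arguments.
Unset Strict Implicit.
Unset Printing Implicit Defensive.

Local Open Scope group_scope.
Local Open Scope classical_set_scope.

Section PointwiseTopology.

(** The product topology is the supremum of the initial topologies of the projections, so a filter
    need only converge for each of these. *)
Lemma prod_topology_cvg (I : Type) (X : I -> topologicalType)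
    (F : set_system (prod_topology X)) (x : prod_topology X) :
  Filter F -> (forall i, (fun y : prod_topology X => y i) @ F --> x i) ->
  F --> x.
Proof.
move=> FF Fx; apply/cvg_sup => i A [_ [[B oB <-] Bx] BA].
by apply: filterS BA _; apply: (Fx i); exact: open_nbhs_nbhs.
Qed.

Lemma prod_topology_eval_continuous (I : Type) (X : I -> topologicalType) i :
  continuous (fun x : prod_topology X => x i).
Proof.
move=> x; have /cvg_sup/(_ i) xx : x --> x by apply: cvg_id.
apply: cvg_trans (@initial_continuous _ _ (fun y : prod_topology X => y i) x).
by move=> A /= /xx.
Qed.

Lemma sval_continuous (X : topologicalType) (A : set X) :
  continuous (sval : A -> X).
Proof. exact: initial_continuous. Qed.

Lemma continuous_set_type (T X : topologicalType) (A : set X) (f : T -> A) :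
  continuous (fun t => sval (f t)) -> continuous f.
Proof.
move=> cf t B [_ [[C oC <-] Ct] CB].
by apply: filterS CB _; apply: cf; exact: open_nbhs_nbhs.
Qed.

(** Locally constant maps into a discrete space are continuous. This serves both directions of the
    homeomorphism, since [Map H] is itself a product, with a constant family. *)
Lemma continuous_into_threads (T : topologicalType) (I : Type)
    (X : I -> discreteTopologicalType)
    (A : set (prod_topology (fun i => X i : topologicalType))) (f : T -> A) :
  (forall i t, \forall s \near t, sval (f s) i = sval (f t) i) -> continuous f.
Proof.
move=> fE; apply: continuous_set_type => t; apply: prod_topology_cvg => i B.
rewrite nbhs_principalE => /principal_filterP Bt.
by apply: filterS (fE i t) => s /= e; rewrite /= e.
Qed.

Lemma nbhs_coordinate (I : Type) (X : I -> discreteTopologicalType)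
    (A : set (prod_topology (fun i => X i : topologicalType))) (x : A) i :
  nbhs x [set y : A | sval y i = sval x i].
Proof.
apply: (@sval_continuous _ A x [set y | y i = sval x i]).
exact: (@prod_topology_eval_continuous _ X i _ _ (discrete_set1 _)).
Qed.

Variables (X : choiceType) (Y : discreteTopologicalType).
Implicit Types (phi psi : {ptws X -> Y}) (F : {fset X}).

Definition agree F phi : set {ptws X -> Y} :=
  [set psi | forall a, a \in F -> psi a = phi a].

Lemma nbhs_agree F phi : nbhs phi (agree F phi).
Proof.
have FF : Filter (nbhs phi) := nbhs_filter phi.
suff : nbhs phi (\bigcap_(a in [set` F]) [set psi | psi a = phi a]).
  by apply: filterS => psi e a aF; exact: e.
apply: filter_bigI => a _.
exact: (@prod_topology_eval_continuous X (fun=> Y) a phi _ (discrete_set1 _)).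
Qed.

(** The sets [agree F phi] generate a filter, unions of finite sets giving intersections; singletons
    [F] make it converge to [phi] at each coordinate, so it refines [nbhs phi]. *)
Lemma nbhs_agreeP phi (A : set {ptws X -> Y}) :
  nbhs phi A -> exists F, agree F phi `<=` A.
Proof.
pose B := filter_from [set: {fset X}] (fun F => agree F phi).
have FB : Filter B.
  apply: filter_from_filter => [|E F _ _]; first by exists fset0.
  exists (E `|` F)%fset => // psi EF.
  by split=> a aF; apply: EF; rewrite in_fsetU aF ?orbT.
have : B --> phi.
  apply: prod_topology_cvg => a C.
  rewrite nbhs_principalE => /principal_filterP Cphi.
  exists [fset a]%fset => // psi /(_ a) /= e.
  by rewrite /= e // fset11.
by move=> Bphi /Bphi[F _ FA]; exists F.
Qed.

End PointwiseTopology.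

Section Schlichting.
Variables (G : groupType) (H : groupClosed G).
Implicit Types (x y : G) (F : {fset coset_space H}).

Lemma eq_coset (K : groupClosed G) x y :
  coset K x = coset K y <-> x^-1 * y \in K.
Proof.
split=> [/(congr1 sval)/= e|Kxy].
  have : lcoset K y y by exists 1; [exact: gpred1|rewrite mulg1].
  by rewrite -e => -[k Kk <-]; rewrite mulKg.
apply: val_inj; rewrite /= eqEsubset; split=> [_ [k Kk <-]|_ [k Kk <-]].
  exists ((x^-1 * y)^-1 * k); first by apply: gpredM => //=; rewrite gpredV.
  by rewrite invgM invgK !mulgA mulgV mul1g.
by exists (x^-1 * y * k); [exact: gpredM|rewrite !mulgA mulgV mul1g].
Qed.

(** At a point [zH] of [F], both sides say that [z^-1 * (x^-1 * y) * z] lies in [H]. *)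
Lemma eq_coset_stab F x y :
  coset (stab F) x = coset (stab F) y <-> agree F (theta H x) (theta H y).
Proof.
rewrite eq_coset; split=> [/stabP sxy a aF|xy].
  have [z az] := cosetP a; rewrite az /theta !translate_coset.
  by apply/esym/eq_coset; rewrite invgM !mulgA -(mulgA _ _ y) sxy // -az.
apply/stabP => z /xy/esym; rewrite /theta !translate_coset => /eq_coset.
by rewrite invgM !mulgA.
Qed.

(** [agree F phi] is a neighbourhood of a point of the closure, hence meets [range (theta H)]. *)
Lemma schlichting_restr (phi : schlichting H) F :
  exists x, agree F (theta H x) (sval phi).
Proof.
have [_ [[x _ <-] xphi]] :=
  set_mem (svalP phi) _ (nbhs_agree F (sval phi)).
by exists x => a /xphi.
Qed.

(** The coset does not depend on the chosen representative, by [eq_coset_stab]. *)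
Definition restr (phi : schlichting H) F : coset_space (stab F) :=
  coset (stab F) (projT1 (cid (schlichting_restr phi F))).

Lemma restrE (phi : schlichting H) F x :
  restr phi F = coset (stab F) x <-> agree F (theta H x) (sval phi).
Proof.
rewrite /restr; case: cid => y /= phiy; rewrite eq_coset_stab.
by split=> e a aF; rewrite ?(phiy a aF) ?(e a aF) // -(phiy a aF) (e a aF).
Qed.

Lemma restr_thread (phi : schlichting H) :
  (restr phi : prod_topology (fun F => coset_space (stab F) : topologicalType))
    \in [set t | forall E F (EF : (E `<=` F)%fset), bonding EF (t F) = t E].
Proof.
apply/mem_set => E F EF; have [x xF] := cosetP (restr phi F).
rewrite xF /bonding coset_map_coset; apply/esym/restrE => a aE.
by have /restrE := xF; apply; exact: (fsubsetP EF).
Qed.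

Definition Phi (phi : schlichting H) : limit_of_quotients H :=
  exist _ (restr phi) (restr_thread phi).

Definition glue (t : limit_of_quotients H) : Map H := fun a =>
  theta H (projT1 (cid (cosetP (sval t [fset a]%fset)))) a.

(** The bonding map from [F] to [{a}] shows that [x] and the representative chosen at [{a}] give the
    same coset there, so they move [a] alike. *)
Lemma glueE (t : limit_of_quotients H) F x :
  sval t F = coset (stab F) x -> agree F (theta H x) (glue t).
Proof.
move=> tF a aF; rewrite /glue; case: cid => y /= ty.
have aF' : ([fset a] `<=` F)%fset by rewrite fsub1set.
have := set_mem (svalP t) _ _ aF'; rewrite tF ty /bonding coset_map_coset.
by move/eq_coset_stab/(_ a); apply; rewrite fset11.
Qed.

Lemma glue_schlichting (t : limit_of_quotients H) :
  glue t \in closure (range (theta H)).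
Proof.
apply/mem_set => A /nbhs_agreeP[F FA]; have [x tx] := cosetP (sval t F).
(* A representative of the component of [t] at [F] gives a translation in the basic neighbourhood
   [agree F (glue t)]. *)
exists (theta H x); split; first by exists x.
by apply: FA => a aF; rewrite (glueE tx).
Qed.

Definition Psi (t : limit_of_quotients H) : schlichting H :=
  exist _ (glue t) (glue_schlichting t).

Lemma PhiK : cancel Phi Psi.
Proof.
move=> phi; apply: val_inj; apply/funext => a /=.
have [x phix] := cosetP (restr phi [fset a]%fset).
rewrite (@glueE (Phi phi) [fset a]%fset x) ?fset11 //.
by have /restrE -> := phix; rewrite ?fset11.
Qed.

Lemma PsiK : cancel Psi Phi.
Proof.
move=> t; apply: val_inj; apply: functional_extensionality_dep => F /=.
have [x tx] := cosetP (sval t F).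
by rewrite tx; apply/restrE; exact: glueE.
Qed.

Lemma Phi_continuous : continuous Phi.
Proof.
apply: (@continuous_into_threads _ _ (fun F => coset_space (stab F)) _ Phi).
move=> F phi.
have [x phix] := cosetP (restr phi F).
have near_phi : \forall psi \near phi, agree F (sval phi) (sval psi).
  exact: sval_continuous (nbhs_agree F (sval phi)).
(* The coordinate at [F] depends only on the values on [F], which are constant near [phi]. *)
apply: filterS near_phi => psi /= phipsi; rewrite phix; apply/restrE => a aF.
by rewrite phipsi //; have /restrE -> := phix.
Qed.

Lemma Psi_continuous : continuous Psi.
Proof.
apply: (@continuous_into_threads _ _ (fun=> coset_space H) _ Psi) => a t.
pose F := [fset a]%fset.
have near_t : nbhs t [set s : limit_of_quotients H | sval s F = sval t F].
  exact: (@nbhs_coordinate _ (fun E => coset_space (stab E))).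
apply: filterS near_t => s st /=.
have [x tx] := cosetP (sval t [fset a]%fset).
(* One [x] represents both [s] and [t] at [{a}], so both glued maps send [a] to [theta H x a]. *)
by rewrite (glueE tx) ?(@glueE s _ _ (etrans st tx)) ?fset11.
Qed.

End Schlichting.

Theorem proposition3p10 (G : groupType) (H : groupClosed G)
    (HeckeH : Hecke_pair H) (redH : reduced H) :
  exists Phi : schlichting H -> limit_of_quotients H,
    homeomorphism Phi /\
    forall (phi : schlichting H) (F : {fset coset_space H}) (x : G),
      sval (Phi phi) F = coset (stab F) x <->
      (forall a : coset_space H, a \in F -> sval phi a = theta H x a).
Proof.
exists (@Phi G H); split; last by move=> phi F x; exact: restrE.
split; first exact: Phi_continuous.
by exists (@Psi G H); split; [exact: PhiK|exact: PsiK|exact: Psi_continuous].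
Qed.
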